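(* Let $V$ be a finite set with $N\ge 1$ elements, let $R\ge 1$, and let $F_1,\dots,F_R:2^V\to\mathbb R$ be submodular functions with $F_r(\emptyset)=0$ for all $r$. Let $\mathcal A=\{(a_1,\dots,a_R)\in\mathbb R^{NR} : \sum_{r=1}^R a_r=0\}$ (each $a_r\in\mathbb R^N$) and $\mathcal B=B(F_1)\times\cdots\times B(F_R)\subseteq\mathbb R^{NR}$. Let $a_0\in\mathcal A$ be arbitrary and define $b_k=\Pi_{\mathcal B}a_k$ and $a_{k+1}=\Pi_{\mathcal A}b_k$ for $k\ge 0$. Then $(a_k,b_k)$ converges to a pair $(a_*,b_* )\in\mathcal A\times\mathcal B$ minimizing $\|a-b\|^2$ over $a\in\mathcal A$, $b\in\mathcal B$, and the convergence is linear with rate $1-\frac{1}{N^2R^2}$: for all $k\ge 0$, $$\|a_k-a_*\|\le 2\|a_0-a_*\|\Bigl(1-\frac{1}{N^2R^2}\Bigr)^k\quad\text{and}\quad \|b_k-b_*\|\le 2\|b_0-b_*\|\Bigl(1-\frac{1}{N^2R^2}\Bigr)^k .$$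
   Context: A set function $F:2^V\to\mathbb R$ is submodular if $F(A)+F(B)\ge F(A\cup B)+F(A\cap B)$ for all $A,B\subseteq V$. A vector $s\in\mathbb R^N=\mathbb R^V$ is identified with the modular set function $s(A)=\sum_{n\in A}s_n$. The base polytope of $F$ is $B(F)=\{s\in\mathbb R^N : s(A)\le F(A)\text{ for all }A\subseteq V,\ s(V)=F(V)\}$. $\Pi_C z$ denotes the Euclidean projection of $z$ onto a nonempty closed convex set $C$; $\|\cdot\|$ is the Euclidean norm. Convention $0^0=1$. *)

(* Defs.v *)
From HB Require Import structures.
From mathcomp Require Import all_boot all_order all_algebra.
From mathcomp Require Import all_classical all_reals all_analysis.
Set Implicit Arguments.
Unset Strict Implicit.
Unset Printing Implicit Defensive.
Import Order.TTheory GRing.Theory Num.Theory.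
Import numFieldNormedType.Exports.
Local Open Scope classical_set_scope.
Local Open Scope ring_scope.

(* Ground-set subsets are finite sets {set V}; a vector of R^V is a
   {ffun V -> K}, and a point (x_1, ..., x_R) of R^(NR) is a
   {ffun 'I_R * V -> K}. *)

Definition submodular (K : realType) (V : finType) (F : {set V} -> K) : Prop :=
  forall A B : {set V},
    F (finset.setU A B) + F (finset.setI A B) <= F A + F B.

Definition modular (K : realType) (V : finType) (s : {ffun V -> K})
  (A : {set V}) : K := \sum_(n in A) s n.

Definition base_polytope (K : realType) (V : finType) (F : {set V} -> K) :
    set {ffun V -> K} :=
  [set s | (forall A : {set V}, modular s A <= F A)
           /\ modular s [set: V]%SET = F [set: V]%SET].

(* The library's norm on finite-dimensional vectors is the sup norm, hence an
   explicit Euclidean norm. *)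
Definition enorm (K : realType) (I : finType) (x : {ffun I -> K}) : K :=
  Num.sqrt (\sum_(i : I) x i ^+ 2).

Definition nearest (K : realType) (I : finType) (C : set {ffun I -> K})
    (z : {ffun I -> K}) : set {ffun I -> K} :=
  [set p | C p /\ forall q, C q -> enorm (z - p) <= enorm (z - q)].

(* For C nonempty, closed and convex, nearest C z is a singleton, so the default
   value z is irrelevant. *)
Definition euclidean_proj (K : realType) (I : finType) (C : set {ffun I -> K})
    (z : {ffun I -> K}) : {ffun I -> K} :=
  xget z (nearest C z).

Definition block (K : realType) (R : nat) (V : finType)
    (x : {ffun 'I_R * V -> K}) (r : 'I_R) : {ffun V -> K} :=
  [ffun n => x (r, n)].

Definition zero_sum (K : realType) (R : nat) (V : finType) :
    set {ffun 'I_R * V -> K} :=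
  [set x | \sum_(r < R) block x r = 0].
Arguments zero_sum : clear implicits.

Definition prod_base (K : realType) (R : nat) (V : finType)
    (F : 'I_R -> {set V} -> K) : set {ffun 'I_R * V -> K} :=
  [set x | forall r : 'I_R, base_polytope (F r) (block x r)].

Definition ecvg (K : realType) (I : finType) (u : nat -> {ffun I -> K})
    (l : {ffun I -> K}) : Prop :=
  (fun k => enorm (u k - l)) @ \oo --> (0 : K).

(* Main.v *)
Require Import Defs.
From HB Require Import structures.
From mathcomp Require Import all_boot all_order all_algebra.
From mathcomp Require Import all_classical all_reals all_analysis.
From mathcomp Require Import ring lra.
Import Order.TTheory GRing.Theory Num.Theory.
Import numFieldNormedType.Exports.
Local Open Scope classical_set_scope.
Local Open Scope ring_scope.
Set Implicit Arguments.
Unset Strict Implicit.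
Unset Printing Implicit Defensive.

(** Write [t] for the point of least norm among the totals [\sum_r x_r] of
    points [x] of the product [B] of the base polytopes, and [v] for [t]
    spread evenly over the [R] blocks.  Then [v] is the shortest vector from
    the zero-sum space [A] to [B], and the best pairs are the [(e, e + v)] with
    [e] in [E = A /\ (B - v)].

    The rate comes from an error bound [d(z, E) <= k d(z, C)], valid for [z] in
    one of the two sets [A] and [B - v], with [C] the other one.  Projecting
    [z] on [C] decreases the squared distance to [E] by at least [d(z, C)^2],
    that is by a factor [1 - 1 / k^2].  A full iteration is two such half steps,
    so the distance itself shrinks by [1 - 1 / k^2].  Alternating projections
    never move away from any point of [E] (Fejer monotonicity); hence the
    iterates converge to a point [astar] of [E], and the distance to [astar] is
    at most twice the distance to [E].  This part
    ([alternating_projections_linear]) holds for any two convex sets with such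
    an error bound, a gap vector orthogonal to the first set, and nearest points
    in [E].

    The error bound with [k = N R] is combinatorial ([prod_base_error_bound]).
    Given [x] in [B], let [y] be the point of [B] with total [t] that is nearest
    to [x], and put [z = x - y].  Draw an arc from [p] to [q] when, in some block
    [r], [z_r] is negative at [p] and positive at [q] and [y_r] may move along
    [chi_q - chi_p] inside its polytope.  Such a move brings [y] closer to [x],
    and moves can be added up by convexity; a directed cycle would combine them
    into a move that keeps the total, contradicting the choice of [y].  So the
    graph is acyclic.  For a vertex [u], take the set [W] of its proper
    ancestors.  No arc enters [W] or [W + u], and submodularity (unions of tight
    sets are tight) turns this into [z_r(W) <= 0] for all [r], with the
    improvement [z_r(u) + z_r(W) <= 0] when [z_r(u) > 0].  Summing over the
    blocks bounds every [|z_r(u)|] by the excess of the total of [x] over [t],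
    namely half the l1 norm of [total z] ([coord_le_excess]).  Cauchy-Schwarz
    then gives [|x - y| <= (N R / 2) |x - u|] for every [u] with total [t], and
    the half leaves room for the triangle inequality that transfers the bound
    from [B - v] to [A]. *)

(** * Euclidean geometry *)

Section Euclid.
Variables (K : realType) (I : finType).
Implicit Types (x y z p q d : {ffun I -> K}) (C : set {ffun I -> K}).

Definition dot x y : K := \sum_i x i * y i.

Definition ray x (c : K) d : {ffun I -> K} := [ffun i => x i + c * d i].

Definition is_convex C := forall p q c, C p -> C q -> 0 <= c <= 1 ->
  C (ray p c (q - p)).

Lemma dotC x y : dot x y = dot y x.
Proof. by apply: eq_bigr => i _; rewrite mulrC. Qed.

Lemma dotDl x y z : dot (x + y) z = dot x z + dot y z.
Proof.
by rewrite -big_split; apply: eq_bigr => i _; rewrite ffunE mulrDl.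
Qed.

Lemma dotNl x z : dot (- x) z = - dot x z.
Proof. by rewrite -sumrN; apply: eq_bigr => i _; rewrite ffunE mulNr. Qed.

Lemma dotDr x y z : dot z (x + y) = dot z x + dot z y.
Proof. by rewrite dotC dotDl !(dotC z). Qed.

Lemma dotNr x z : dot z (- x) = - dot z x.
Proof. by rewrite dotC dotNl dotC. Qed.

Lemma dotr0 x : dot x 0 = 0.
Proof. by rewrite /dot big1 // => i _; rewrite [X in _ * X]ffunE mulr0. Qed.

Definition dotE := (dotDl, dotDr, dotNl, dotNr).

Lemma dot_ge0 x : 0 <= dot x x.
Proof. by apply: sumr_ge0 => i _; rewrite -expr2 sqr_ge0. Qed.

Lemma dot_eq0 x : dot x x = 0 -> x = 0.
Proof.
move=> /eqP; rewrite psumr_eq0 => [/allP h|i _]; last by rewrite -expr2 sqr_ge0.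
apply/ffunP => i; rewrite ffunE.
by have := h i (mem_index_enum i); rewrite mulf_eq0 orbb => /eqP.
Qed.

Lemma enorm_sqr x : enorm x ^+ 2 = dot x x.
Proof.
rewrite /enorm sqr_sqrtr; first by apply: eq_bigr => i _; rewrite expr2.
by apply: sumr_ge0 => i _; rewrite sqr_ge0.
Qed.

Lemma enorm_ge0 x : 0 <= enorm x.
Proof. exact: sqrtr_ge0. Qed.

Lemma ler_enorm x (c : K) : 0 <= c -> (enorm x <= c) = (dot x x <= c ^+ 2).
Proof. by move=> c0; rewrite -enorm_sqr ler_pXn2r ?nnegrE ?enorm_ge0. Qed.

Lemma enorm_eq0 x : enorm x = 0 -> x = 0.
Proof. by move=> h; apply: dot_eq0; rewrite -enorm_sqr h expr0n. Qed.

Lemma enormN x : enorm (- x) = enorm x.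
Proof. by apply/eqP; rewrite eq_le !ler_enorm ?enorm_ge0 // !enorm_sqr !dotE; lra. Qed.

Lemma enormB x y : enorm (x - y) = enorm (y - x).
Proof. by rewrite -enormN opprB. Qed.

Lemma dot_ray x c d : dot (ray x c d) (ray x c d)
  = dot x x + 2 * c * dot x d + c ^+ 2 * dot d d.
Proof.
rewrite /dot !mulr_sumr -!big_split; apply: eq_bigr => i _ /=.
by rewrite ffunE; ring.
Qed.

Lemma cauchy_schwarz x y : dot x y ^+ 2 <= dot x x * dot y y.
Proof.
have := dot_ge0 y; rewrite le_eqVlt => /orP[/eqP y0|y0].
  by rewrite (dot_eq0 (esym y0)) !dotr0 expr0n mulr0.
have := dot_ge0 (ray x (- (dot x y / dot y y)) y).
rewrite dot_ray.
have -> : dot x x + 2 * - (dot x y / dot y y) * dot x y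
   + (- (dot x y / dot y y)) ^+ 2 * dot y y
   = (dot x x * dot y y - dot x y ^+ 2) / dot y y by field; rewrite gt_eqF.
by rewrite pmulr_lge0 ?invr_gt0 // subr_ge0.
Qed.

Lemma enormD x y : enorm (x + y) <= enorm x + enorm y.
Proof.
rewrite ler_enorm ?addr_ge0 ?enorm_ge0 // sqrrD !enorm_sqr !dotE (dotC y x).
suff : dot x y <= enorm x * enorm y by rewrite mulr2n; lra.
rewrite (le_trans (ler_norm _)) // -(ler_pXn2r (n := 2)) ?nnegrE ?normr_ge0 //.
  by rewrite exprMn !enorm_sqr real_normK ?num_real // cauchy_schwarz.
by rewrite mulr_ge0 ?enorm_ge0.
Qed.

Lemma enorm_dist y x z : enorm (x - z) <= enorm (x - y) + enorm (y - z).
Proof. by rewrite (le_trans _ (enormD _ _)) // addrA subrK. Qed.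

(** First-order optimality in one variable: [e] tends to [0]. *)
Lemma slope_ge0 (b c : K) :
  (forall e, 0 < e <= 1 -> 0 <= 2 * e * b + e ^+ 2 * c) -> 0 <= b.
Proof.
move=> h; rewrite leNgt; apply/negP => b0.
have [c0|c0] := leP c 0.
  by have := h 1; rewrite ltr01 lexx => /(_ isT); lra.
(* at e = min(1, - b / c) the linear term beats the quadratic one *)
have m0 : 0 < Num.min 1 (- b / c).
  by rewrite lt_min ltr01 divr_gt0 // oppr_gt0.
have := h (Num.min 1 (- b / c)); rewrite m0 ge_min lexx => /(_ isT).
set m := Num.min _ _ in m0 *.
have : m * c <= - b by rewrite -ler_pdivlMr // ge_min lexx orbT.
move=> mc h1; have : 0 <= m * (2 * b + m * c) by rewrite (le_trans h1)//; lra.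
by rewrite pmulr_rge0 //; lra.
Qed.

(** Comparing [p] with the points of the segment from [p] to [q] close to [p]:
    the variational inequality that characterises projections on convex
    sets. *)
Lemma nearest_obtuse C z p q : is_convex C -> nearest C z p -> C q ->
  dot (z - p) (q - p) <= 0.
Proof.
move=> cC [Cp h] Cq; rewrite -oppr_ge0.
apply: (@slope_ge0 _ (dot (q - p) (q - p))) => e /andP[e0 e1].
have := h _ (cC p q e Cp Cq _); rewrite (ltW e0) e1 => /(_ isT).
rewrite ler_enorm ?enorm_ge0 // enorm_sqr.
have -> : z - ray p e (q - p) = ray (z - p) (- e) (q - p).
  by apply/ffunP => i; rewrite !ffunE; ring.
by rewrite dot_ray; lra.
Qed.

Lemma nearest_proj C z : (exists p, nearest C z p) ->
  nearest C z (euclidean_proj C z).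
Proof. by move=> h; apply: xgetPex. Qed.

Lemma dot_le_sup x (c : K) : (forall i, `|x i| <= c) ->
  dot x x <= #|I|%:R * c ^+ 2.
Proof.
move=> h; rewrite -sum1_card natr_sum mulr_suml; apply: ler_sum => i _.
rewrite mul1r -expr2 -real_normK ?num_real //.
by rewrite ler_pXn2r ?nnegrE // (le_trans _ (h i)).
Qed.

Lemma coord_le_enorm x i : `|x i| <= enorm x.
Proof.
rewrite -(ler_pXn2r (n := 2)) ?nnegrE ?enorm_ge0 // enorm_sqr real_normK ?num_real //.
rewrite /dot (bigD1 i) //= -expr2 lerDl sumr_ge0 // => j _.
by rewrite -expr2 sqr_ge0.
Qed.

Lemma sqr_sum_le x : (\sum_i x i) ^+ 2 <= #|I|%:R * dot x x.
Proof.
have := cauchy_schwarz [ffun=> 1] x.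
congr (_ ^+ 2 <= _ * _).
  by apply: eq_bigr => i _; rewrite ffunE mul1r.
by rewrite /dot -sum1_card natr_sum; apply: eq_bigr => i _; rewrite ffunE mulr1.
Qed.

Lemma sqr_sum_norm_le x : (\sum_i `|x i|) ^+ 2 <= #|I|%:R * dot x x.
Proof.
have := sqr_sum_le [ffun i => `|x i|].
congr (_ ^+ 2 <= _ * _); apply: eq_bigr => i _; rewrite !ffunE //.
by rewrite -expr2 real_normK ?num_real.
Qed.

End Euclid.

(** * Existence of minimisers *)

Section Compactness.
Variables (K : realType) (I : finType).
Implicit Types (C : set {ffun I -> K}).

(** Closedness and continuity for finite functions are read on row vectors,
    through this linear bijection. *)
Definition of_row (v : 'rV[K]_#|I|) : {ffun I -> K} :=
  [ffun i => v 0 (enum_rank i)].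

Definition rclosed C := closed [set v | C (of_row v)].

Definition rcontinuous (f : {ffun I -> K} -> K) := continuous (f \o of_row).

Lemma of_row_surj x : exists v, of_row v = x.
Proof.
exists (\row_j x (enum_val j)); apply/ffunP => i.
by rewrite ffunE mxE enum_rankK.
Qed.

Lemma rcontinuous_coord i : rcontinuous (fun x => x i).
Proof.
move=> v; rewrite /continuous_at /comp ffunE; under eq_fun do rewrite ffunE.
exact: coord_continuous.
Qed.

Lemma rcontinuous_sum (J : finType) (P : pred J) (f : J -> {ffun I -> K} -> K) :
  (forall j, P j -> rcontinuous (f j)) ->
  rcontinuous (fun x => \sum_(j | P j) f j x).
Proof.
move=> h; rewrite /rcontinuous /comp.
apply: (@continuous_big _ _ (@GRing.add K) 0 P _ _ _ (fun j v => f j (of_row v))) => //.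
exact: (@pseudometric_normed_Zmodule.add_continuous K K^o).
Qed.

Lemma rcontinuous_sqr f c : rcontinuous f -> rcontinuous (fun x => (c - f x) ^+ 2).
Proof.
move=> h v.
have g_cvg : (fun w => c - f (of_row w)) @ v --> c - f (of_row v).
  by apply: (@cvgB K K^o _ (nbhs v) _ (cst c) (f \o of_row));
    [exact: cvg_cst | exact: h].
exact: (@cvgM K _ (nbhs v) _ _ _ _ _ g_cvg g_cvg).
Qed.

Lemma rclosed_le f c : rcontinuous f -> rclosed [set x | f x <= c].
Proof.
move=> cf.
by apply: (@preimage_closed _ _ (f \o of_row) [set y | y <= c]) => [v _|];
  [exact: cf | exact: closed_le].
Qed.

Lemma rclosed_eq f c : rcontinuous f -> rclosed [set x | f x = c].
Proof.
move=> cf.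
by apply: (@preimage_closed _ _ (f \o of_row) [set y | y = c]) => [v _|];
  [exact: cf | exact: closed_eq].
Qed.

Lemma rclosedI C C' : rclosed C -> rclosed C' -> rclosed [set x | C x /\ C' x].
Proof. exact: closedI. Qed.

Lemma rclosed_forall (J : Type) (C : J -> set {ffun I -> K}) :
  (forall j, rclosed (C j)) -> rclosed [set x | forall j, C j x].
Proof.
move=> h; rewrite /rclosed.
have -> : [set v | [set x | forall j, C j x] (of_row v)]
   = \bigcap_(j in [set: J]) [set v | C j (of_row v)].
  by apply/seteqP; split => v /= hv j; [move=> _|]; apply: hv.
by apply: closed_bigI => j _; apply: h.
Qed.

Lemma rclosed_argmin C f (M : K) : C !=set0 -> rclosed C ->
  (forall x i, C x -> `|x i| <= M) -> rcontinuous f ->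
  exists2 p, C p & forall q, C q -> f p <= f q.
Proof.
move=> [x Cx] clC bC cf.
pose D := [set v | C (of_row v)].
have cD : compact D.
  apply: (subclosed_compact clC
    (rV_compact (A := fun=> [set y : K | y \in `[-M, M]]) _)).
    by move=> i; exact: segment_compact.
  move=> v Dv i /=; have := bC _ (enum_val i) Dv.
  by rewrite ffunE enum_valK ler_norml in_itv.
have D0 : D !=set0.
  by have [v vx] := of_row_surj x; exists v; rewrite /D /= vx.
have [v /set_mem Dv hv] := EVT_min_rV D0 cD (continuous_subspaceT cf).
exists (of_row v) => // q; have [w <-] := of_row_surj q => Cw.
by apply: hv; apply: mem_set.
Qed.

Lemma ex_nearest C (M : K) z : C !=set0 -> rclosed C ->
  (forall x i, C x -> `|x i| <= M) -> exists p, nearest C z p.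
Proof.
move=> C0 clC bC.
have [|p Cp hp] := rclosed_argmin (f := fun x => dot (z - x) (z - x)) C0 clC bC.
  have -> : (fun x => dot (z - x) (z - x)) = (fun x => \sum_i (z i - x i) ^+ 2).
    by apply/funext => x; apply: eq_bigr => i _; rewrite !ffunE expr2.
  apply: rcontinuous_sum => j _; apply: rcontinuous_sqr.
  exact: rcontinuous_coord.
exists p; split => // q Cq; rewrite ler_enorm ?enorm_ge0 // enorm_sqr.
exact: hp.
Qed.

End Compactness.

(** * Base polytopes and tight sets *)

Section BasePolytope.
Variables (K : realType) (V : finType).
Implicit Types (s x z : {ffun V -> K}) (F : {set V} -> K) (A B S T U W : {set V}).

(** The direction [chi_w - chi_v]: mass moves from [v] to [w]. *)
Definition exchange (v w : V) : {ffun V -> K} :=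
  [ffun n => (n == w)%:R - (n == v)%:R].

Lemma modularE s A : modular s A = \sum_n (n \in A)%:R * s n.
Proof.
rewrite /modular big_mkcond; apply: eq_bigr => n _.
by case: (n \in A); rewrite ?mul1r ?mul0r.
Qed.

Lemma modularB s x A : modular (s - x) A = modular s A - modular x A.
Proof.
by rewrite /modular -sumrB; apply: eq_bigr => n _; rewrite !ffunE.
Qed.

Lemma modular_ray s c x A : modular (ray s c x) A = modular s A + c * modular x A.
Proof.
by rewrite /modular mulr_sumr -big_split; apply: eq_bigr => n _; rewrite ffunE.
Qed.

Lemma modularUI s A B :
  modular s (A :|: B)%SET + modular s (A :&: B)%SET = modular s A + modular s B.
Proof.
rewrite !modularE -!big_split; apply: eq_bigr => n _ /=; rewrite !inE.
by case: (n \in A); case: (n \in B) => /=; ring.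
Qed.

Lemma dot_exchange x v w : dot x (exchange v w) = x w - x v.
Proof.
have pick u : \sum_n x n * (n == u)%:R = x u.
  rewrite (bigD1 u) //= eqxx mulr1 big1 ?addr0 //.
  by move=> n /negbTE ->; rewrite mulr0.
rewrite -!pick -sumrB; apply: eq_bigr => n _.
by rewrite ffunE mulrBr.
Qed.

Lemma modular_exchange v w A :
  modular (exchange v w) A = (w \in A)%:R - (v \in A)%:R.
Proof.
have := dot_exchange [ffun n => (n \in A)%:R] v w; rewrite !ffunE => <-.
by rewrite modularE; apply: eq_bigr => n _; rewrite [in RHS]ffunE.
Qed.

Lemma base_polytope_convex F : is_convex (base_polytope F).
Proof.
move=> p q c [p_le p_eq] [q_le q_eq] /andP[c0 c1]; split => [A|].
  rewrite modular_ray modularB.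
  have := ler_wpM2l c0 (q_le A); have := ler_wpM2l (_ : 0 <= 1 - c) (p_le A).
  by rewrite subr_ge0 => /(_ c1); lra.
by rewrite modular_ray modularB p_eq q_eq subrr mulr0 addr0.
Qed.

(** A coordinate is bounded above through the set [{n}], and below through its
    complement, since the total mass is prescribed. *)
Lemma base_polytope_bounded F : exists M, forall s n,
  base_polytope F s -> `|s n| <= M.
Proof.
exists (\sum_(A : {set V}) `|F A| + \sum_(A : {set V}) `|F A|) => s n [s_le s_eq].
have F_le A : `|F A| <= \sum_(B : {set V}) `|F B|.
  by rewrite (bigD1 A) //= lerDl sumr_ge0.
have n_le : s n <= F [set n]%SET by have := s_le [set n]%SET; rewrite /modular big_set1.
have n_ge : F [set: V]%SET - F [set~ n]%SET <= s n.
  rewrite lerBlDr -s_eq /modular (bigD1 n) ?inE //= lerD2l.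
  have -> : \sum_(i in [set: V]%SET | i != n) s i = modular s [set~ n]%SET.
    by apply: eq_bigl => i; rewrite !inE.
  exact: s_le.
have := F_le [set n]%SET; have := F_le [set~ n]%SET; have := F_le [set: V]%SET.
move: (\sum_B _) => M; rewrite !ler_norml => /andP[? ?] /andP[? ?] /andP[? ?].
by apply/andP; split; lra.
Qed.

Variable F : {set V} -> K.
Hypotheses (F_submod : submodular F) (F_empty : F finset.set0 = 0).

(** The greedy algorithm: adding the elements one at a time, each receives the
    marginal gain of [F]. *)
Lemma base_polytope_nonempty : base_polytope F !=set0.
Proof.
suff [x [x_le x_eq]] : exists x,
    (forall A, A \subset [set n in enum V]%SET -> modular x A <= F A) /\
    modular x [set n in enum V]%SET = F [set n in enum V]%SET.
  have eV : [set n in enum V]%SET = [set: V]%SET.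
    by apply/setP => n; rewrite !inE mem_enum.
  by exists x; split => [A|]; [apply: x_le; rewrite eV | rewrite -eV].
elim: (enum V) (enum_uniq V) => [_|e l IH /= /andP[el ul]].
  have e0 : [set n in [::]]%SET = finset.set0 :> {set V}.
    by apply/setP => n; rewrite !inE.
  exists 0; rewrite e0; split => [A|]; last by rewrite /modular big_set0 F_empty.
  by rewrite finset.subset0 => /eqP ->; rewrite /modular big_set0 F_empty.
have [x [x_le x_eq]] := IH ul; set S := [set n in l]%SET in x_le x_eq.
have eS : [set n in e :: l]%SET = (e |: S)%SET.
  by apply/setP => n; rewrite !inE.
have e_S : e \notin S by rewrite inE.
pose y : {ffun V -> K} := [ffun n => if n == e then F (e |: S)%SET - F S else x n].
have y_x A : e \notin A -> modular y A = modular x A.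
  move=> eA; apply: eq_bigr => n nA; rewrite ffunE.
  by case: eqP nA eA => // -> ->.
exists y; rewrite eS; split; last first.
  by rewrite /modular big_setU1 //= ffunE eqxx -/(modular y S) y_x // x_eq subrK.
move=> A A_sub; have [eA|eA] := boolP (e \in A); last first.
  rewrite y_x //; apply: x_le; apply/fintype.subsetP => n nA.
  have := fintype.subsetP A_sub n nA; rewrite in_setU1 => /orP[/eqP ne|//].
  by rewrite -ne nA in eA.
rewrite /modular (big_setD1 e) //= ffunE eqxx -/(modular y _) y_x ?setD11 //.
have AS : (A :\ e)%SET \subset S by rewrite finset.subDset.
have := F_submod A S.
have -> : (A :|: S)%SET = (e |: S)%SET.
  apply/eqP; rewrite finset.eqEsubset finset.subUset A_sub finset.subsetUr /=.
  by rewrite finset.setSU // finset.sub1set.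
have -> : (A :&: S)%SET = (A :\ e)%SET.
  apply/setP => n; rewrite !inE; have [->|ne] := eqVneq n e.
    by rewrite (negbTE el) andbF.
  have [nA|//] := boolP (n \in A).
  by have := fintype.subsetP A_sub n nA; rewrite !inE (negbTE ne).
by have := x_le _ AS; lra.
Qed.

Section Tight.
Variable s : {ffun V -> K}.
Hypothesis s_base : base_polytope F s.

Definition tight A := modular s A == F A.

(** Uncrossing: tight sets form a lattice. *)
Lemma tightUI A B : tight A -> tight B ->
  tight (A :|: B)%SET && tight (A :&: B)%SET.
Proof.
case: s_base => s_le _ /eqP tA /eqP tB.
have := modularUI s A B; have := F_submod A B.
have := s_le (A :|: B)%SET; have := s_le (A :&: B)%SET.
by rewrite tA tB => ? ? ? ?; apply/andP; split; apply/eqP; lra.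
Qed.

(** The least tight set containing [w]; mass can flow into [w] exactly from the
    elements of [dep w]. *)
Definition dep w : {set V} := (\bigcap_(A | tight A && (w \in A)) A)%SET.

Lemma tight_dep w : tight (dep w).
Proof.
apply: (big_ind tight) => [|A B tA tB|A /andP[]//].
  by rewrite /tight s_base.2.
by have /andP[] := tightUI tA tB.
Qed.

Lemma tight_bigcup_dep W (P : pred V) : tight (\bigcup_(w in W | P w) dep w)%SET.
Proof.
apply: (big_ind tight) => [|A B tA tB|w _]; last exact: tight_dep.
  by rewrite /tight /modular big_set0 F_empty.
by have /andP[] := tightUI tA tB.
Qed.

Lemma mem_dep w : w \in dep w.
Proof. by apply/bigcapP => A /andP[]. Qed.

(** Only the constraints of sets with [w] but not [v] tighten along the
    exchange; none of them is tight, so the least slack is a legal step. *)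
Lemma exchange_feasible v w : v \in dep w ->
  exists2 e, 0 < e & base_polytope F (ray s e (exchange v w)).
Proof.
move=> /bigcapP vw; case: s_base => s_le s_eq.
exists (\big[Num.min/1]_(A : {set V} | (w \in A) && (v \notin A)) (F A - modular s A)).
  apply: lt_bigmin => // A /andP[wA vA]; rewrite subr_gt0 lt_neqAle s_le andbT.
  by apply: contra vA => tA; apply: vw; rewrite /tight tA wA.
set e := bigop _ _ _.
have e_ge0 : 0 <= e.
  by apply: le_bigmin => // A _; rewrite subr_ge0 s_le.
split=> [A|]; rewrite modular_ray modular_exchange; last first.
  by rewrite !inE subrr mulr0 addr0 s_eq.
have [wA|wA] := boolP (w \in A); have [vA|vA] := boolP (v \in A) => /=;
  rewrite ?subrr ?subr0 ?sub0r ?mulr1 ?mulr0 ?addr0 ?s_le //; last first.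
  by have := s_le A; lra.
have : e <= F A - modular s A by apply: bigmin_le_cond; rewrite wA vA.
lra.
Qed.

(** A cut inequality for the exchange arcs of [s] towards [x].  If every arc
    that ends in [W] starts in [U], the union [T] of the sets [dep w], for [w]
    in [W] with [x w > s w], is tight; so [x - s] is nonpositive on [T], which
    contains the positive part of [W] and meets the negative part only in
    [U]. *)
Lemma exchange_closed_le x W U : base_polytope F x ->
  (forall v w, w \in W -> 0 < x w - s w -> x v - s v < 0 -> v \in dep w ->
    v \in U) ->
  \sum_n ((n \in W)%:R * Num.max 0 (x n - s n)
        + (n \in U)%:R * Num.min 0 (x n - s n)) <= 0.
Proof.
move=> [x_le _] hU.
pose T := (\bigcup_(w in W | (0 < x w - s w)) dep w)%SET.
have tT : modular s T = F T by apply/eqP; exact: tight_bigcup_dep.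
have : modular (x - s) T <= 0 by rewrite modularB tT subr_le0.
apply: le_trans; rewrite modularE; apply: ler_sum => n _; rewrite !ffunE.
have [zn|zn|zn] := ltgtP 0 (x n - s n); last by rewrite -zn !mulr0 addr0.
- rewrite mulr0 addr0; apply: ler_wpM2r; first exact: ltW.
  case: (boolP (n \in W)) => [nW|_]; last by rewrite ler0n.
  suff -> : n \in T by [].
  by apply/bigcupP; exists n; rewrite ?nW ?zn ?mem_dep.
- rewrite mulr0 add0r; apply: ler_wnM2r; first exact: ltW.
  case: (boolP (n \in T)) => [/bigcupP[w /andP[wW zw] nw]|_]; last by rewrite ler0n.
  by rewrite (hU _ _ wW zw zn nw).
Qed.

End Tight.
End BasePolytope.

(** * The product polytope and its fibers over the total *)

Section Product.
Variables (K : realType) (V : finType) (R : nat).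
Implicit Types (x y z d : {ffun 'I_R * V -> K}) (t : {ffun V -> K}).

Definition total x : {ffun V -> K} := [ffun n => \sum_(r < R) x (r, n)].

Lemma total_blocks x : \sum_(r < R) block x r = total x.
Proof.
by apply/ffunP => n; rewrite sum_ffunE ffunE; apply: eq_bigr => r _; rewrite ffunE.
Qed.

Lemma zero_sumP x : zero_sum K R V x <-> total x = 0.
Proof. by rewrite /zero_sum /= total_blocks. Qed.

Lemma totalB x y : total (x - y) = total x - total y.
Proof.
by apply/ffunP => n; rewrite !ffunE -sumrB; apply: eq_bigr => r _; rewrite !ffunE.
Qed.

Lemma totalD x y : total (x + y) = total x + total y.
Proof.
by apply/ffunP => n; rewrite !ffunE -big_split; apply: eq_bigr => r _; rewrite !ffunE.
Qed.

Lemma total_ray x c d : total (ray x c d) = ray (total x) c (total d).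
Proof.
apply/ffunP => n; rewrite !ffunE mulr_sumr -big_split.
by apply: eq_bigr => r _; rewrite !ffunE.
Qed.

Lemma block_ray x c d r : block (ray x c d) r = ray (block x r) c (block d r).
Proof. by apply/ffunP => n; rewrite !ffunE. Qed.

Lemma blockB x y r : block (x - y) r = block x r - block y r.
Proof. by apply/ffunP => n; rewrite !ffunE. Qed.

Lemma dot_blocks x y : dot x y = \sum_(r < R) dot (block x r) (block y r).
Proof.
rewrite pair_bigA; apply: eq_bigr => -[r n] _ /=; by rewrite !ffunE.
Qed.

Variable F : 'I_R -> {set V} -> K.

(** The points [y] of [B] for which [y - v] lies in the zero-sum space, when [v]
    has total [t]. *)
Definition fiber t : set {ffun 'I_R * V -> K} :=
  [set x | prod_base F x /\ total x = t].

Lemma prod_base_convex : is_convex (prod_base F).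
Proof.
move=> p q c Bp Bq hc r; rewrite block_ray blockB.
exact: base_polytope_convex.
Qed.

Lemma fiber_convex t : is_convex (fiber t).
Proof.
move=> p q c [Bp tp] [Bq tq] hc; split; first exact: prod_base_convex.
rewrite total_ray totalB tp tq subrr.
by apply/ffunP => n; rewrite !ffunE mulr0 addr0.
Qed.

Lemma prod_base_bounded : exists M, forall x i, prod_base F x -> `|x i| <= M.
Proof.
have [M hM] := choice (fun r => base_polytope_bounded (F r)).
exists (\sum_r `|M r|) => x [r n] Bx.
have /(_ n) := hM r _ _ (Bx r); rewrite ffunE => /le_trans; apply.
by rewrite (le_trans (ler_norm _)) // (bigD1 r) //= lerDl sumr_ge0.
Qed.

Lemma prod_base_rclosed : rclosed (prod_base F).
Proof.
have lin r A : rcontinuous (fun x : {ffun 'I_R * V -> K} => modular (block x r) A).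
  rewrite (_ : (fun x => _) = fun x => \sum_(n in A) x (r, n)); last first.
    by apply/funext => x; apply: eq_bigr => n _; rewrite ffunE.
  by apply: rcontinuous_sum => n _; exact: rcontinuous_coord.
apply: rclosed_forall => r; apply: rclosedI; last exact: rclosed_eq.
by apply: rclosed_forall => A; exact: rclosed_le.
Qed.

Lemma total_rcontinuous n : rcontinuous (fun x => total x n).
Proof.
rewrite (_ : (fun x => _) = fun x => \sum_r x (r, n)); last first.
  by apply/funext => x; rewrite ffunE.
by apply: rcontinuous_sum => r _; exact: rcontinuous_coord.
Qed.

Lemma fiber_rclosed t : rclosed (fiber t).
Proof.
have -> : fiber t = [set x | prod_base F x /\ forall n, total x n = t n].
  apply/seteqP; split => x /= [Bx tx]; split => //; first by rewrite tx.
  exact/ffunP.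
apply: rclosedI; first exact: prod_base_rclosed.
by apply: rclosed_forall => n; exact/rclosed_eq/total_rcontinuous.
Qed.

Lemma prod_base_nearest z : prod_base F !=set0 -> exists p, nearest (prod_base F) z p.
Proof.
have [M hM] := prod_base_bounded => B0.
exact: (ex_nearest z B0 prod_base_rclosed hM).
Qed.

Lemma fiber_nearest t z : fiber t !=set0 -> exists p, nearest (fiber t) z p.
Proof.
have [M hM] := prod_base_bounded => B0.
by apply: (ex_nearest (M := M) z B0 (@fiber_rclosed t)) => x i [Bx _]; exact: hM.
Qed.

(** The last inequality is first-order optimality of the least-norm total; it
    makes the spread of [total y] the gap vector between the two sets. *)
Lemma min_total : prod_base F !=set0 -> exists2 y, prod_base F y &
  forall x, prod_base F x -> dot (total y) (total y) <= dot (total y) (total x).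
Proof.
move=> B0; have [M hM] := prod_base_bounded.
have [|y By ymin] := rclosed_argmin (f := fun x => \sum_n (0 - total x n) ^+ 2)
  B0 prod_base_rclosed hM.
  by apply: rcontinuous_sum => n _; apply: rcontinuous_sqr; exact: total_rcontinuous.
exists y => // x Bx.
have sqE u : \sum_n (0 - total u n) ^+ 2 = dot (total u) (total u).
  by apply: eq_bigr => n _; rewrite sub0r sqrrN expr2.
rewrite -subr_ge0 -dotNr -dotDr.
apply: (@slope_ge0 _ _ (dot (total (x - y)) (total (x - y)))) => e /andP[e0 e1].
have := ymin _ (prod_base_convex By Bx (c := e) _).
rewrite (ltW e0) e1 => /(_ isT); rewrite !sqE total_ray dot_ray totalB; lra.
Qed.

Definition feasible y d := exists2 e, 0 < e & prod_base F (ray y e d).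

(** With steps [e1] and [e2], the step [e1 e2 / (e1 + e2)] along the sum lands on
    the segment between the two end points. *)
Lemma feasibleD y d1 d2 : feasible y d1 -> feasible y d2 -> feasible y (d1 + d2).
Proof.
move=> [e1 e1_gt0 B1] [e2 e2_gt0 B2]; exists (e1 * e2 / (e1 + e2)).
  by rewrite divr_gt0 ?mulr_gt0 ?addr_gt0.
have e12 : 0 < e1 + e2 by rewrite addr_gt0.
have := prod_base_convex B1 B2 (c := e1 / (e1 + e2)).
rewrite divr_ge0 ?(ltW e12) ?(ltW e1_gt0) // ler_pdivrMr // mul1r lerDl (ltW e2_gt0).
move=> /(_ isT); congr prod_base; apply/ffunP => i; rewrite !ffunE.
by field; rewrite gt_eqF.
Qed.

Lemma feasible0 y : prod_base F y -> feasible y 0.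
Proof.
move=> By; exists 1 => //; rewrite (_ : ray y 1 0 = y) //.
by apply/ffunP => i; rewrite !ffunE mulr0 addr0.
Qed.

Hypotheses (F_submod : forall r, submodular (F r))
  (F_empty : forall r, F r finset.set0 = 0).

Lemma prod_base_nonempty : prod_base F !=set0.
Proof.
have [y hy] := choice (fun r => base_polytope_nonempty (F_submod r) (F_empty r)).
exists [ffun i => y i.1 i.2] => r.
by rewrite (_ : block _ r = y r) //; apply/ffunP => n; rewrite !ffunE.
Qed.

(** * The exchange graph at a nearest point of a fiber *)

Section ExchangeGraph.
Variables (x y : {ffun 'I_R * V -> K}).
Hypotheses (Bx : prod_base F x) (By : prod_base F y).
Hypothesis y_opt : forall d, feasible y d -> total d = 0 -> dot (x - y) d <= 0.

Let z := x - y.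

Definition exchange_arc (v w : V) : bool :=
  [exists r, [&& 0 < z (r, w), z (r, v) < 0 & v \in dep (F r) (block y r) w]].

(** An arc is a feasible move in a single block, and it brings [y] closer to
    [x]: its scalar product with [z = x - y] is positive. *)
Lemma exchange_arc_direction v w : exchange_arc v w ->
  exists d, [/\ feasible y d, total d = exchange K v w & 0 < dot z d].
Proof.
move=> /existsP[r /and3P[zw zv vw]].
have [e e0 Be] := exchange_feasible (By r) vw.
pose d : {ffun 'I_R * V -> K} :=
  [ffun i => if i.1 == r then exchange K v w i.2 else 0].
have d_r : block d r = exchange K v w by apply/ffunP => n; rewrite !ffunE eqxx.
have d_ne r' : r' != r -> block d r' = 0.
  by move=> /negbTE ne; apply/ffunP => n; rewrite !ffunE ne.
exists d; split.
- exists e => // r'; rewrite block_ray; have [->|ne] := eqVneq r' r.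
    by rewrite d_r.
  rewrite d_ne // (_ : ray _ _ _ = block y r') //.
  by apply/ffunP => n; rewrite !ffunE mulr0 addr0.
- by rewrite -total_blocks (bigD1 r) //= d_r big1 ?addr0.
- rewrite dot_blocks (bigD1 r) //= d_r [X in _ + X]big1 ?addr0; last first.
    by move=> r' ne; rewrite d_ne // dotr0.
  have zE n : block z r n = z (r, n) by exact: ffunE.
  by rewrite dot_exchange !zE subr_gt0 (lt_trans zv zw).
Qed.

Lemma connect_direction v w : connect exchange_arc v w ->
  exists d, [/\ feasible y d, total d = exchange K v w & 0 <= dot z d].
Proof.
move=> /connectP[p + ->]; elim: p v => [|u p IH] v /=.
  move=> _; exists 0; split; first exact: feasible0.
    apply/ffunP => n; rewrite !ffunE subrr big1 // => r _; exact: ffunE.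
  by rewrite dotr0.
move=> /andP[/exchange_arc_direction[d [fd td zd]] /IH[d' [fd' td' zd']]].
exists (d + d'); split; first exact: feasibleD.
  by rewrite totalD td td'; apply/ffunP => n; rewrite !ffunE; ring.
by rewrite dotDr addr_ge0 // ltW.
Qed.

(** Around a cycle the exchanges cancel in the total, so their sum would be a
    feasible move inside the fiber towards [x]. *)
Lemma exchange_arc_acyclic v w : exchange_arc v w -> ~~ connect exchange_arc w v.
Proof.
move=> /exchange_arc_direction[d [fd td zd]]; apply/negP.
move=> /connect_direction[d' [fd' td' zd']].
have := y_opt (feasibleD fd fd'); rewrite dotDr totalD td td'.
have -> : exchange K v w + exchange K w v = 0.
  by apply/ffunP => n; rewrite !ffunE; ring.
by move=> /(_ erefl); rewrite -/z; lra.
Qed.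

Let pos n := Num.max 0 (z n).
Let neg n := Num.min 0 (z n).

Lemma posDneg i : pos i + neg i = z i.
Proof. by rewrite /pos /neg; case: ltgtP => // h; rewrite ?addr0 ?add0r. Qed.

Definition ancestral (W : {set V}) := forall v w, w \in W -> exchange_arc v w -> v \in W.

(** [exchange_closed_le] in block [r].  Allowing [U] to be smaller than [W]
    serves a vertex of [W] that receives arcs from [W] but sends none to it. *)
Lemma ancestral_inflow_le r (W U : {set V}) :
  (forall v w, w \in W -> 0 < z (r, w) -> z (r, v) < 0 -> exchange_arc v w -> v \in U) ->
  \sum_n ((n \in W)%:R * pos (r, n) + (n \in U)%:R * neg (r, n)) <= 0.
Proof.
move=> hU.
have := exchange_closed_le (F_submod r) (F_empty r) (By r) (W := W) (U := U) (Bx r).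
rewrite (eq_bigr (fun n => (n \in W)%:R * pos (r, n) + (n \in U)%:R * neg (r, n))).
  apply=> v w wW; have zE n : block x r n - block y r n = z (r, n).
    by rewrite !ffunE.
  rewrite !zE => zw zv vw; apply: (hU v w) => //.
  by apply/existsP; exists r; rewrite zw zv.
by move=> n _; rewrite /pos /neg /z !ffunE.
Qed.

Lemma ancestral_le r (W : {set V}) : ancestral W -> modular (block z r) W <= 0.
Proof.
move=> hW; rewrite modularE.
have := @ancestral_inflow_le r W W (fun v w wW _ _ => hW v w wW).
by congr (_ <= _); apply: eq_bigr => n _; rewrite -mulrDr posDneg !ffunE.
Qed.

Lemma sum_total (W : {set V}) :
  \sum_r modular (block z r) W = modular (total z) W.
Proof.
rewrite exchange_big; apply: eq_bigr => n _; rewrite ffunE.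
by apply: eq_bigr => r _; rewrite ffunE.
Qed.

Lemma ancestral_total_le r (W : {set V}) : ancestral W ->
  modular (total z) W <= modular (block z r) W.
Proof.
move=> hW; rewrite -sum_total (bigD1 r) //= gerDl sumr_le0 // => r' _.
exact: ancestral_le.
Qed.

(** All points of [B] have the same mass, so [total z] sums to zero and its
    negative part weighs half its l1 norm. *)
Lemma total_excess (W : {set V}) :
  - modular (total z) W <= (\sum_n `|total z n|) / 2.
Proof.
have : \sum_n total z n = 0.
  transitivity (modular (total z) [set: V]%SET).
    by rewrite modularE; apply: eq_bigr => n _; rewrite inE mul1r.
  rewrite -sum_total big1 // => r _.
  by rewrite blockB modularB (Bx r).2 (By r).2 subrr.
move=> sum0; rewrite ler_pdivlMr // mulr_natr mulr2n -{1}[- _]addr0 -{1}sum0.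
rewrite modularE -addrA [X in _ + X](_ : _ = \sum_n (1 - (n \in W)%:R) * total z n).
  rewrite -sumrN -big_split; apply: ler_sum => n _ /=.
  by case: (n \in W) => /=; have := ler_norm (total z n);
    have := ler_norm (- total z n); rewrite normrN; lra.
rewrite -sumrB; apply: eq_bigr => n _; ring.
Qed.

(** The heart of the error bound.  Acyclicity makes the proper ancestors [W] of
    [u] closed under predecessors, with or without [u] added.  If [z (r, u)] is
    positive, what enters [u] in block [r] leaves [W], and [W] gains no mass in
    the other blocks; if it is negative, apply the same count to [W] with
    [u]. *)
Lemma coord_le_excess r u : `|z (r, u)| <= (\sum_n `|total z n|) / 2.
Proof.
pose W := [set w | connect exchange_arc w u && (w != u)]%SET.
have W_anc : ancestral W.
  move=> v w; rewrite !inE => /andP[wu _] vw.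
  rewrite (connect_trans (connect1 vw)) //=; apply: contraL wu => /eqP <-.
  exact: exchange_arc_acyclic.
have uW : u \notin W by rewrite !inE eqxx andbF.
have arcW v : exchange_arc v u -> v \in W.
  move=> vu; rewrite inE (connect1 vu) /=; apply: contraTneq (vu) => ->.
  by apply/negP => uu; have := exchange_arc_acyclic uu; rewrite connect0.
have W'_anc : ancestral (u |: W)%SET.
  move=> v w; rewrite !in_setU1 => /orP[/eqP ->|wW] vw; last first.
    by rewrite (W_anc _ _ wW vw) orbT.
  by rewrite arcW ?orbT.
have blockU : modular (block z r) (u |: W)%SET = z (r, u) + modular (block z r) W.
  by rewrite /modular big_setU1 //= ffunE.
rewrite ler_norml; apply/andP; split; last first.
  have [z0|z0] := leP (z (r, u)) 0.
    by rewrite (le_trans z0) // divr_ge0 // sumr_ge0.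
  apply: le_trans (total_excess W).
  rewrite lerNr; apply: le_trans (ancestral_total_le r W_anc) _.
  rewrite -subr_le0 opprK addrC -blockU modularE.
  have := @ancestral_inflow_le r (u |: W)%SET W.
  rewrite (eq_bigr (fun n => (n \in (u |: W)%SET)%:R * block z r n)).
    apply=> v w /setU1P[-> _ _|wW _ _]; [exact: arcW | exact: W_anc].
  move=> n _; rewrite [block z r n]ffunE in_setU1 -posDneg.
  have [->|_] := eqVneq n u; last by rewrite /= mulrDr.
  by rewrite (negbTE uW) !mul1r mul0r /neg min_l ?ltW.
rewrite -lerN2 opprK; apply: le_trans (total_excess (u |: W)%SET).
rewrite lerN2 (le_trans (ancestral_total_le r W'_anc)) // blockU.
by rewrite gerDl ancestral_le.
Qed.

End ExchangeGraph.
End Product.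

(** * The error bound *)

Section ErrorBound.
Variables (K : realType) (V : finType) (R : nat) (F : 'I_R -> {set V} -> K).
Hypotheses (F_submod : forall r, submodular (F r))
  (F_empty : forall r, F r finset.set0 = 0).

(** Cauchy-Schwarz in each column. *)
Lemma dot_total_le (w : {ffun 'I_R * V -> K}) :
  dot (total w) (total w) <= R%:R * dot w w.
Proof.
have -> : dot w w = \sum_n \sum_r w (r, n) * w (r, n).
  rewrite exchange_big pair_bigA; apply: eq_bigr => -[r n] _ //.
rewrite mulr_sumr; apply: ler_sum => n _; rewrite ffunE -expr2.
have := sqr_sum_le [ffun r => w (r, n)]; rewrite card_ord /dot.
by congr (_ ^+ 2 <= _ * _); apply: eq_bigr => r _; rewrite !ffunE.
Qed.

(** The coordinate bound yields the constant [N R / 2], which is at most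
    [N R - 1] as soon as [N R >= 2].  If [N R = 1], the same inequality with
    [u = y] reads [4 |x - y|^2 <= |x - y|^2], so [x = y]. *)
Lemma prod_base_error_bound (t : {ffun V -> K}) (x : {ffun 'I_R * V -> K}) :
  (0 < #|V|)%N -> (0 < R)%N ->
  fiber F t !=set0 -> prod_base F x ->
  exists2 y, fiber F t y & forall u, total u = t ->
    enorm (x - y) <= (#|V|%:R * R%:R - 1) * enorm (x - u).
Proof.
move=> V_gt0 R_gt0 fib0 Bx; have [y y_near] := fiber_nearest x fib0.
have [By ty] := y_near.1; exists y => //.
have y_opt d : feasible F y d -> total d = 0 -> dot (x - y) d <= 0.
  move=> [e e0 Be] td.
  have := nearest_obtuse (@fiber_convex _ _ _ F t) y_near.
  move=> /(_ (ray y e d)); rewrite (_ : ray y e d - y = ray 0 e d); last first.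
    by apply/ffunP => i; rewrite !ffunE; ring.
  have -> : dot (x - y) (ray 0 e d) = e * dot (x - y) d.
    by rewrite /dot mulr_sumr; apply: eq_bigr => i _; rewrite [ray _ _ _ _]ffunE
      [(0 : {ffun _}) i]ffunE; ring.
  rewrite pmulr_rle0 //; apply; split => //.
  by rewrite total_ray td ty; apply/ffunP => n; rewrite !ffunE mulr0 addr0.
set NR : K := _ * _.
have NR_ge1 : NR = 1 \/ 2 <= NR.
  rewrite /NR -natrM; have : (0 < #|V| * R)%N by rewrite muln_gt0 V_gt0.
  case: (#|V| * R)%N => // -[|k] _; first by left.
  by right; rewrite (ler_nat K 2).
have main u : total u = t ->
    4 * dot (x - y) (x - y) <= NR ^+ 2 * dot (x - u) (x - u).
  move=> tu.
  have tE : total (x - u) = total (x - y) by rewrite !totalB tu ty.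
  have le1 := dot_le_sup (fun i => let: (r, n) := i in
    coord_le_excess F_submod F_empty Bx By y_opt r n).
  set S := \sum_n _ in le1.
  have le2 : S ^+ 2 <= #|V|%:R * dot (total (x - y)) (total (x - y)).
    exact: sqr_sum_norm_le.
  have le3 := dot_total_le (x - u).
  rewrite card_prod card_ord natrM in le1.
  rewrite tE in le3.
  have le4 : S ^+ 2 <= #|V|%:R * (R%:R * dot (x - u) (x - u)).
    by rewrite (le_trans le2) // ler_wpM2l.
  have : R%:R * #|V|%:R * S ^+ 2 <=
      R%:R * #|V|%:R * (#|V|%:R * (R%:R * dot (x - u) (x - u))).
    by rewrite ler_wpM2l // mulr_ge0.
  by move: le1; rewrite /NR expr_div_n; lra.
move=> u tu.
case: NR_ge1 => [NR1|NR2].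
  have /enorm_eq0 -> : enorm (x - y) = 0.
    apply/eqP; rewrite -sqrf_eq0 enorm_sqr; apply/eqP.
    by have := main y ty; have := dot_ge0 (x - y); rewrite NR1; lra.
  by rewrite NR1 subrr mul0r ler_enorm // expr0n dotr0.
have NR1 : 0 <= NR - 1 by lra.
rewrite ler_enorm ?mulr_ge0 ?enorm_ge0 // exprMn enorm_sqr.
have : NR ^+ 2 <= 4 * (NR - 1) ^+ 2.
  have : 0 <= (NR - 2) * (3 * NR - 2) by apply: mulr_ge0; lra.
  lra.
move=> /(ler_wpM2r (dot_ge0 (x - u))).
by have := main u tu; lra.
Qed.

End ErrorBound.

(** * Convergence of Fejer monotone sequences *)

Section Fejer.
Variables (K : realType) (I : finType).
Implicit Types (E : set {ffun I -> K}) (u : nat -> {ffun I -> K}).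

Lemma geometric_cvg0 (M rho : K) : 0 <= rho -> rho < 1 ->
  (fun k => M * rho ^+ k) @ \oo --> (0 : K).
Proof. by move=> r0 r1; apply: cvg_geometric; rewrite ger0_norm. Qed.

Lemma le_geometric (M rho p : K) k : 0 <= rho -> rho < 1 ->
  (forall j, (k <= j)%N -> p <= M * rho ^+ j) -> p <= 0.
Proof.
move=> r0 r1 h.
apply: (cvgr_to_ge (geometric_cvg0 M r0 r1)).
by exists k => // j /= /h.
Qed.

(** The limit is built coordinatewise as the supremum of the lower bounds
    [u j i - g j], where [g j] bounds all later displacements.  It belongs to
    [E] because its nearest point in [E] is at distance zero. *)
Lemma fejer_limit E u (C rho : K) : 0 <= rho -> rho < 1 ->
  (forall z, exists e, nearest E z e) ->
  (forall k e, E e -> enorm (u k.+1 - e) <= enorm (u k - e)) ->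
  (forall k, exists2 e, E e & enorm (u k - e) <= C * rho ^+ k) ->
  exists2 ustar, E ustar &
    forall k e, E e -> enorm (ustar - e) <= enorm (u k - e).
Proof.
move=> r0 r1 E_near fejer u_E.
have mono k j e : (k <= j)%N -> E e -> enorm (u j - e) <= enorm (u k - e).
  move=> + Ee; elim: j => [|j IH]; first by rewrite leqn0 => /eqP ->.
  by rewrite leq_eqVlt ltnS => /orP[/eqP -> //|/IH]; apply: le_trans; exact: fejer.
(* going from step k to a later one through a point of E that is within
   C rho^k of u k *)
pose g k := 2 * C * rho ^+ k.
have g_ge0 k : 0 <= g k.
  have [e _ he] := u_E k; have := le_trans (enorm_ge0 _) he.
  by rewrite /g; lra.
have gap k j i : (k <= j)%N -> `|u j i - u k i| <= g k.
  move=> kj; have [e Ee he] := u_E k; have := mono _ _ _ kj Ee.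
  have := enorm_dist e (u j) (u k); rewrite (enormB e).
  have := coord_le_enorm (u j - u k) i; rewrite !ffunE /g; lra.
have gap2 k j i : u j i - g j <= u k i + g k.
  have := g_ge0 k; have := g_ge0 j.
  by case: (leqP k j) => [/gap|/ltnW/gap] /(_ i); rewrite ler_norml => /andP[]; lra.
pose S i := [set u j i - g j | j in [set: nat]].
have S_ub k i : ubound (S i) (u k i + g k) by move=> _ [j _ <-].
have S_sup i : has_sup (S i).
  by split; [exists (u 0%N i - g 0%N), 0%N | exists (u 0%N i + g 0%N)].
pose x : {ffun I -> K} := [ffun i => sup (S i)].
have x_near k i : `|(u k - x) i| <= g k.
  rewrite !ffunE ler_norml; apply/andP; split.
    by have : sup (S i) <= u k i + g k by [apply: ge_sup => //; exact: (S_sup i).1]; lra.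
  have : u k i - g k <= sup (S i) by apply: (ub_le_sup (S_sup i).2); exists k.
  by lra.
have x_lim k : enorm (u k - x) <= #|I|%:R * g k.
  rewrite ler_enorm; last exact: mulr_ge0 (ler0n _ _) (g_ge0 k).
  apply: le_trans (dot_le_sup (x_near k)) _.
  rewrite [leRHS]exprMn ler_wpM2r ?sqr_ge0 // -natrX ler_nat.
  by case: #|I| => // n; rewrite leq_pmulr.
have Ex : E x.
  have [p [Ep hp]] := E_near x.
  have : enorm (x - p) <= 0.
    apply: (@le_geometric (#|I|%:R * (2 * C) + C) rho _ 0%N) => // j _.
    have [e Ee he] := u_E j; apply: le_trans (hp _ Ee) _.
    have := enorm_dist (u j) x e; rewrite (enormB x (u j)); have := x_lim j.
    by rewrite /g; lra.
  rewrite le_eqVlt ltNge enorm_ge0 orbF => /eqP/enorm_eq0/eqP.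
  by rewrite subr_eq0 => /eqP ->.
exists x => // k e Ee; rewrite -subr_le0.
apply: (@le_geometric (#|I|%:R * (2 * C)) rho _ k) => // j kj.
have := mono _ _ _ kj Ee; have := enorm_dist (u j) x e; rewrite (enormB x (u j)).
by have := x_lim j; rewrite /g; lra.
Qed.

End Fejer.

(** * Alternating projections under an error bound *)

Section AlternatingProjections.
Variables (K : realType) (I : finType).
Implicit Types (x y z h : {ffun I -> K}).
Variables (A B : set {ffun I -> K}) (v : {ffun I -> K}) (kappa : K).
Hypotheses (A_seg : is_convex A) (B_seg : is_convex B).

(** The [A]-side of the pairs at displacement [v]; the hypotheses below make [v]
    the gap vector, so these are the best approximation pairs ([gap_min]). *)
Definition best_points : set {ffun I -> K} := [set e | A e /\ B (e + v)].
Local Notation E := best_points.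

Hypothesis kappa_ge1 : 1 <= kappa.
Hypothesis v_perp : forall x y, A x -> A y -> dot v (x - y) = 0.
Hypothesis v_min : forall y e, B y -> E e -> 0 <= dot v (y - v - e).
Hypothesis E_near : forall z, exists e, nearest E z e.
Hypothesis error_bound : forall y, B y -> exists2 e, E e &
  forall x, A x -> enorm (y - v - e) <= (kappa - 1) * enorm (y - v - x).

Let rho : K := 1 - 1 / kappa ^+ 2.

Lemma rho_ge0 : 0 <= rho.
Proof.
have k0 : 0 < kappa by apply: lt_le_trans kappa_ge1.
by rewrite /rho subr_ge0 ler_pdivrMr ?exprn_gt0 // mul1r expr_ge1 // ltW.
Qed.

Lemma rho_lt1 : rho < 1.
Proof.
have k0 : 0 < kappa by apply: lt_le_trans kappa_ge1.
by rewrite /rho gtrDl oppr_lt0 divr_gt0 ?exprn_gt0.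
Qed.

Lemma gap_min x y e : A x -> B y -> E e ->
  enorm v ^+ 2 <= enorm (x - y) ^+ 2.
Proof.
move=> Ax By Ee; rewrite !enorm_sqr.
have := v_min By Ee; have := v_perp Ee.1 Ax.
have := dot_ge0 (y - v - x).
have -> : x - y = - (v + (y - v - x)) by apply/ffunP => i; rewrite !ffunE; ring.
rewrite !dotE (dotC y v) (dotC x v) (dotC y x); lra.
Qed.

(** Pythagoras with an obtuse angle, after translating [B] by the gap vector. *)
Lemma project_B x y e : A x -> nearest B x y -> E e ->
  dot (y - v - e) (y - v - e) <= dot (x - e) (x - e) - dot (y - v - x) (y - v - x).
Proof.
move=> Ax xy Ee.
have := nearest_obtuse B_seg xy Ee.2; have := v_min xy.1 Ee.
rewrite !dotE (dotC y v) (dotC y x) (dotC e v) (dotC e x) (dotC e y) (dotC x v).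
lra.
Qed.

Lemma project_A x y e : B y -> nearest A y x -> E e ->
  dot (x - e) (x - e) <= dot (y - v - e) (y - v - e) - dot (y - v - x) (y - v - x).
Proof.
move=> By yx Ee.
have := nearest_obtuse A_seg yx Ee.1; have := v_perp yx.1 Ee.1.
rewrite !dotE (dotC y v) (dotC y x) (dotC e v) (dotC e x) (dotC e y) (dotC x v).
lra.
Qed.

(** The squared distance from [z] to [E] is at most [c].  A witness avoids
    infima, and squares let the two half steps compose. *)
Definition sqdist_le z (c : K) := exists2 e, E e & dot (z - e) (z - e) <= c.

(** [q] and [p] are the squared distances to [E] before and after a projection,
    and [gap] is the squared length of that step. *)
Lemma contraction (p q gap c : K) : 0 <= q -> q <= c ->
  q <= kappa ^+ 2 * gap -> p <= q - gap -> p <= rho * c.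
Proof.
move=> q0 qc qg pq.
have k0 : 0 < kappa by apply: lt_le_trans kappa_ge1.
have : rho * q <= rho * c by rewrite ler_wpM2l ?rho_ge0.
have : q / kappa ^+ 2 <= gap by rewrite ler_pdivrMr ?exprn_gt0 // mulrC.
by rewrite /rho div1r; lra.
Qed.

(** The error bound for a point [x] of [A] follows from the one at its
    projection [y] by the triangle inequality: [(kappa - 1) + 1 = kappa]. *)
Lemma sqdist_le_project_B x y c : A x -> nearest B x y -> sqdist_le x c ->
  sqdist_le (y - v) (rho * c).
Proof.
move=> Ax xy [e' Ee' xc]; have [e [Ee x_near]] := E_near x; exists e => //.
apply: contraction (dot_ge0 (x - e)) _ _ (project_B Ax xy Ee).
  by rewrite (le_trans _ xc) // -!enorm_sqr ler_pXn2r ?nnegrE ?enorm_ge0 ?x_near.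
have [e1 Ee1 /(_ x Ax) he1] := error_bound xy.1.
have k0 : 0 <= kappa by apply: le_trans kappa_ge1.
rewrite -!enorm_sqr -exprMn ler_pXn2r ?nnegrE ?mulr_ge0 ?enorm_ge0 //.
have := x_near _ Ee1; have := enorm_dist (y - v) x e1.
by rewrite (enormB x (y - v)); lra.
Qed.

Lemma sqdist_le_project_A x y c : B y -> nearest A y x -> sqdist_le (y - v) c ->
  sqdist_le x (rho * c).
Proof.
move=> By yx [e' Ee' yc]; have [e [Ee y_near]] := E_near (y - v); exists e => //.
apply: contraction (dot_ge0 (y - v - e)) _ _ (project_A By yx Ee).
  by rewrite (le_trans _ yc) // -!enorm_sqr ler_pXn2r ?nnegrE ?enorm_ge0 ?y_near.
have [e1 Ee1 /(_ x yx.1) he1] := error_bound By.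
have k0 : 0 <= kappa by apply: le_trans kappa_ge1.
rewrite -!enorm_sqr -exprMn ler_pXn2r ?nnegrE ?mulr_ge0 ?enorm_ge0 //.
by have := y_near _ Ee1; have := enorm_ge0 (y - v - x); lra.
Qed.

Variables a b : nat -> {ffun I -> K}.
Hypothesis A_a0 : A (a 0%N).
Hypothesis b_near : forall k, nearest B (a k) (b k).
Hypothesis a_near : forall k, nearest A (b k) (a k.+1).

Lemma A_a k : A (a k).
Proof. by case: k => [//|k]; have [] := a_near k. Qed.

Lemma sqdist_le_a k c : sqdist_le (a 0%N) (c ^+ 2) ->
  sqdist_le (a k) ((c * rho ^+ k) ^+ 2).
Proof.
move=> h; elim: k => [|k IH]; first by rewrite mulr1.
have := sqdist_le_project_A (b_near k).1 (a_near k)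
  (sqdist_le_project_B (A_a k) (b_near k) IH).
by rewrite mulrA -expr2 -exprMn mulrCA -exprS.
Qed.

Lemma sqdist_le_b k c : sqdist_le (b 0%N - v) (c ^+ 2) ->
  sqdist_le (b k - v) ((c * rho ^+ k) ^+ 2).
Proof.
move=> h; elim: k => [|k IH]; first by rewrite mulr1.
have := sqdist_le_project_B (A_a k.+1) (b_near k.+1)
  (sqdist_le_project_A (b_near k).1 (a_near k) IH).
by rewrite mulrA -expr2 -exprMn mulrCA -exprS.
Qed.

Lemma fejer_B k e : E e -> enorm (b k - v - e) <= enorm (a k - e).
Proof.
move=> Ee; rewrite ler_enorm ?enorm_ge0 // enorm_sqr.
have := project_B (A_a k) (b_near k) Ee.
by have := dot_ge0 (b k - v - a k); lra.
Qed.

Lemma fejer_A k e : E e -> enorm (a k.+1 - e) <= enorm (b k - v - e).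
Proof.
move=> Ee; rewrite ler_enorm ?enorm_ge0 // enorm_sqr.
have := project_A (b_near k).1 (a_near k) Ee.
by have := dot_ge0 (b k - v - a k.+1); lra.
Qed.

Lemma sqdist_le_nearest z : exists2 e, E e /\ sqdist_le z (enorm (z - e) ^+ 2) &
  forall e', E e' -> enorm (z - e) <= enorm (z - e').
Proof.
have [e [Ee he]] := E_near z; exists e => //; split => //.
by exists e; rewrite ?enorm_sqr.
Qed.

(** The same point [astar] serves both sequences: between [a k] and [a k.+1] the
    shifted iterate [b k - v] is no farther from [E] than the former and no
    closer than the latter. *)
Lemma alternating_projections_linear : exists2 astar, E astar & forall k,
  enorm (a k - astar) <= 2 * enorm (a 0%N - astar) * rho ^+ k /\
  enorm (b k - (astar + v)) <= 2 * enorm (b 0%N - (astar + v)) * rho ^+ k.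
Proof.
have [ea [_ a0_le] ea_min] := sqdist_le_nearest (a 0%N).
have [eb [_ b0_le] eb_min] := sqdist_le_nearest (b 0%N - v).
have r0 := rho_ge0.
have witness z c k : 0 <= c -> sqdist_le z ((c * rho ^+ k) ^+ 2) ->
    exists2 e, E e & enorm (z - e) <= c * rho ^+ k.
  move=> c0 [e Ee he]; exists e => //.
  by rewrite ler_enorm ?mulr_ge0 ?exprn_ge0.
have [astar Ea a_fejer] : exists2 astar, E astar & forall k e, E e ->
    enorm (astar - e) <= enorm (a k - e).
  apply: (fejer_limit r0 rho_lt1 E_near (C := enorm (a 0%N - ea))) => [k e Ee|k].
    exact: le_trans (fejer_A k Ee) (fejer_B k Ee).
  by apply: witness; [exact: enorm_ge0 | exact: sqdist_le_a].
exists astar => // k; split.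
  have [e Ee he] := witness _ _ _ (enorm_ge0 _) (sqdist_le_a k a0_le).
  have := a_fejer k e Ee; have := enorm_dist e (a k) astar; rewrite (enormB e).
  have : enorm (a 0%N - ea) * rho ^+ k <= enorm (a 0%N - astar) * rho ^+ k.
    by rewrite ler_wpM2r ?exprn_ge0 // ea_min.
  by lra.
have bE j : b j - (astar + v) = b j - v - astar.
  by apply/ffunP => i; rewrite !ffunE; ring.
have [e Ee he] := witness _ _ _ (enorm_ge0 _) (sqdist_le_b k b0_le).
have := a_fejer k.+1 e Ee; have := fejer_A k Ee.
have := enorm_dist e (b k - v) astar; rewrite (enormB e) !bE.
have : enorm (b 0%N - v - eb) * rho ^+ k <= enorm (b 0%N - v - astar) * rho ^+ k.
  by rewrite ler_wpM2r ?exprn_ge0 // eb_min.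
by lra.
Qed.

End AlternatingProjections.

(** * Projection on the zero-sum space *)

Section Spread.
Variables (K : realType) (V : finType) (R : nat).
Hypothesis R_gt0 : (0 < R)%N.

Definition spread (t : {ffun V -> K}) : {ffun 'I_R * V -> K} :=
  [ffun i => t i.2 / R%:R].

Lemma dot_spread t x : dot (spread t) x = dot t (total x) / R%:R.
Proof.
rewrite dot_blocks exchange_big mulr_suml; apply: eq_bigr => n _.
rewrite ffunE mulr_sumr mulr_suml; apply: eq_bigr => r _.
by rewrite !ffunE mulrAC.
Qed.

Lemma total_spread t : total (spread t) = t.
Proof.
apply/ffunP => n; rewrite ffunE (eq_bigr (fun=> t n / R%:R)) => [|r _]; last first.
  by rewrite ffunE.
by rewrite sumr_const card_ord -[LHS]mulr_natr divfK // pnatr_eq0 -lt0n.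
Qed.

(** The nearest zero-sum point removes from each block the mean of the blocks. *)
Lemma zero_sum_nearest z : exists p, nearest (zero_sum K R V) z p.
Proof.
exists (z - spread (total z)); split.
  by apply/zero_sumP; rewrite totalB total_spread subrr.
move=> q /zero_sumP q0.
rewrite subKr ler_enorm ?enorm_ge0 // enorm_sqr dot_spread total_spread.
rewrite ler_pdivrMr ?ltr0n // mulrC.
by have := dot_total_le (z - q); rewrite totalB q0 subr0.
Qed.

Lemma zero_sum_convex : is_convex (zero_sum K R V).
Proof.
move=> p q c /zero_sumP p0 /zero_sumP q0 _; apply/zero_sumP.
rewrite total_ray totalB p0 q0 subrr.
by apply/ffunP => n; rewrite !ffunE mulr0 addr0.
Qed.

End Spread.

(** * Decomposable submodular functions *)

Lemma ecvg_geometric (K : realType) (I : finType) (u : nat -> {ffun I -> K}) l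
    (M rho : K) : 0 <= rho -> rho < 1 ->
  (forall k, enorm (u k - l) <= M * rho ^+ k) -> ecvg u l.
Proof.
move=> r0 r1 h; apply: (squeeze_cvgr _ (cvg_cst 0) (geometric_cvg0 M r0 r1)).
by apply: nearW => k; rewrite enorm_ge0 h.
Qed.

Theorem theorem12 (K : realType) (V : finType) (N R : nat)
  (hN : #|V| = N) (N_ge1 : (1 <= N)%N) (R_ge1 : (1 <= R)%N)
  (F : 'I_R -> {set V} -> K)
  (F_submod : forall r : 'I_R, submodular (F r))
  (F_empty : forall r : 'I_R, F r finset.set0 = 0)
  (a b : nat -> {ffun 'I_R * V -> K})
  (a0_in : zero_sum K R V (a 0%N))
  (b_def : forall k : nat, b k = euclidean_proj (prod_base F) (a k))
  (a_def : forall k : nat, a k.+1 = euclidean_proj (zero_sum K R V) (b k)) :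
  exists astar bstar : {ffun 'I_R * V -> K},
    [/\ zero_sum K R V astar /\ prod_base F bstar,
        forall x y : {ffun 'I_R * V -> K},
          zero_sum K R V x -> prod_base F y ->
          enorm (astar - bstar) ^+ 2 <= enorm (x - y) ^+ 2,
        ecvg a astar /\ ecvg b bstar
      & forall k : nat,
          enorm (a k - astar)
            <= 2 * enorm (a 0%N - astar)
               * (1 - 1 / (N%:R ^+ 2 * R%:R ^+ 2)) ^+ k
          /\
          enorm (b k - bstar)
            <= 2 * enorm (b 0%N - bstar)
               * (1 - 1 / (N%:R ^+ 2 * R%:R ^+ 2)) ^+ k].
Proof.
have B0 := prod_base_nonempty F_submod F_empty.
have [ymin Bymin total_min] := min_total B0.
set t := total ymin in total_min.
have fib0 : fiber F t !=set0 by exists ymin.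
pose v := spread R t.
have total_v : total v = t by exact: total_spread.
pose A := zero_sum K R V; pose B := prod_base F.
have bestP e : best_points A B v e <-> fiber F t (e + v).
  split=> [[/zero_sumP Ae Be]|[Be te]]; split => //.
    by rewrite totalD Ae add0r.
  apply/zero_sumP; move: te; rewrite totalD total_v => /(canRL (addrK _)).
  by rewrite subrr.
have kappa_ge1 : 1 <= N%:R * R%:R :> K.
  by rewrite -natrM (ler_nat K 1) muln_gt0 N_ge1.
have v_perp x y : A x -> A y -> dot v (x - y) = 0.
  move=> /zero_sumP Ax /zero_sumP Ay; rewrite dot_spread totalB Ax Ay subrr.
  by rewrite dotr0 mul0r.
have v_min y e : B y -> best_points A B v e -> 0 <= dot v (y - v - e).
  move=> By [/zero_sumP Ae _]; rewrite dot_spread !totalB Ae total_v subr0.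
  by rewrite divr_ge0 // dotDr dotNr subr_ge0 total_min.
have E_near z : exists e, nearest (best_points A B v) z e.
  have [p [fp p_near]] := fiber_nearest (z + v) fib0; exists (p - v); split.
    by apply/bestP; rewrite subrK.
  move=> q /bestP/p_near.
  have zE w : z - (w - v) = z + v - w by rewrite opprB addrA.
  by rewrite zE => /le_trans; apply; rewrite opprD addrACA subrr addr0.
have v_bound y : B y -> exists2 e, best_points A B v e &
    forall x, A x -> enorm (y - v - e) <= (N%:R * R%:R - 1) * enorm (y - v - x).
  move=> By; have V_gt0 : (0 < #|V|)%N by rewrite hN.
  have [p fp p_le] := prod_base_error_bound F_submod F_empty V_gt0 R_ge1 fib0 By.
  exists (p - v) => [|x /zero_sumP Ax]; first by apply/bestP; rewrite subrK.
  have -> : y - v - (p - v) = y - p by rewrite opprB addrA subrK.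
  rewrite (_ : y - v - x = y - (x + v)); last by rewrite opprD addrA addrAC.
  rewrite -hN; apply: p_le.
  by rewrite totalD total_v Ax add0r.
have b_near k : nearest B (a k) (b k).
  by rewrite b_def; apply/nearest_proj/prod_base_nearest.
have a_near k : nearest A (b k) (a k.+1).
  by rewrite a_def; apply/nearest_proj/zero_sum_nearest.
have A_seg : is_convex A by exact: zero_sum_convex.
have B_seg : is_convex B by exact: prod_base_convex.
have [astar Ea rate] := alternating_projections_linear A_seg B_seg kappa_ge1
  v_perp v_min E_near v_bound a0_in b_near a_near.
rewrite -exprMn; exists astar, (astar + v); split; first by case: Ea.
- move=> x y Ax By; rewrite opprD addNKr enormN.
  exact: (gap_min v_perp v_min Ax By Ea).
- have r0 := rho_ge0 kappa_ge1; have r1 := rho_lt1 kappa_ge1.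
  split.
    by apply: (ecvg_geometric r0 r1 (fun k => (rate k).1)).
  by apply: (ecvg_geometric r0 r1 (fun k => (rate k).2)).
- exact: rate.
Qed.
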